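(* Fix $a,c\in\mathbb{C}$ with $\operatorname{Re} c>\operatorname{Re} a>0$ and $\tau,\beta>0$ with $\tau-\beta<1$. Let $\alpha\in\mathbb{C}$ with $\sigma=\operatorname{Re}\alpha>1$ and $r\in\mathbb{C}$ with $\operatorname{Re} r>0$ or $r=0$, and assume $\int_0^\infty \frac{t^{\sigma-1}e^{-t}}{1-e^{-t}}\,|\Phi^{\tau,\beta}(a;c;-r/t)|\,dt<\infty$. Then $\zeta^{2r}(\alpha)$ is defined (its integral converges absolutely) and $$\zeta^{r}(\alpha)-2^{1-\alpha}\zeta^{2r}(\alpha)=\frac{1}{\Gamma(\alpha)}\int_0^\infty\frac{t^{\alpha-1}e^{-t}}{1+e^{-t}}\,\Phi^{\tau,\beta}\Big(a;c;-\frac{r}{t}\Big)\,dt .$$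
   Context: For $\tau,\beta>0$ with $\tau-\beta<1$ and $a,c\in\mathbb{C}$, the $(\tau,\beta)$-confluent hypergeometric function is the entire function $\Phi^{\tau,\beta}(a;c;z)=\frac{\Gamma(c)}{\Gamma(a)}\sum_{n=0}^{\infty}\frac{\Gamma(a+\tau n)}{\Gamma(c+\beta n)}\frac{z^n}{n!}$ (equal, for $\operatorname{Re}c>\operatorname{Re}a>0$, to $\frac{\Gamma(c)}{\Gamma(a)\Gamma(c-a)}\int_0^1 t^{a-1}(1-t)^{c-a-1}\sum_{k\ge0}\frac{\Gamma(c+\tau k)}{\Gamma(c+\beta k)}\frac{(zt^{\tau})^k}{k!}dt$). Generalized zeta function: $\zeta^{r}(\alpha)=\frac{1}{\Gamma(\alpha)}\int_0^\infty \frac{t^{\alpha-1}e^{-t}}{1-e^{-t}}\,\Phi^{\tau,\beta}(a;c;-r/t)\,dt$ for $\operatorname{Re}\alpha>1$, $\operatorname{Re}r>0$ or $r=0$, with $a,c,\tau,\beta$ fixed. *)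

(* Defs.v *)
From Stdlib Require Import Reals Lra Arith Factorial ClassicalEpsilon.
Open Scope R_scope.

Definition Cx := (R * R)%type.
Definition Re (z : Cx) : R := fst z.
Definition Im (z : Cx) : R := snd z.
Definition Cof (x : R) : Cx := (x, 0).
Definition Czero : Cx := (0, 0).
Definition Cone : Cx := (1, 0).
Definition Cadd (z w : Cx) : Cx := (Re z + Re w, Im z + Im w).
Definition Copp (z : Cx) : Cx := (- Re z, - Im z).
Definition Csub (z w : Cx) : Cx := Cadd z (Copp w).
Definition Cmul (z w : Cx) : Cx :=
  (Re z * Re w - Im z * Im w, Re z * Im w + Im z * Re w).
Definition Cinv (z : Cx) : Cx :=
  let d := Re z ^ 2 + Im z ^ 2 in (Re z / d, - Im z / d).
Definition Cdiv (z w : Cx) : Cx := Cmul z (Cinv w).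
Definition Cnorm (z : Cx) : R := sqrt (Re z ^ 2 + Im z ^ 2).
Fixpoint Cpown (z : Cx) (n : nat) : Cx :=
  match n with O => Cone | S m => Cmul z (Cpown z m) end.
Definition Cexp (z : Cx) : Cx := (exp (Re z) * cos (Im z), exp (Re z) * sin (Im z)).
Definition Rcpow (t : R) (z : Cx) : Cx := Cexp (Cmul z (Cof (ln t))).

Definition is_RInt (f : R -> R) (x y v : R) : Prop :=
  exists pr : Riemann_integrable f x y, RiemannInt pr = v.

Definition improper_intR (f : R -> R) (L : R) : Prop :=
  forall eps : R, 0 < eps ->
    exists d M : R, 0 < d /\ d <= M /\
      forall x y : R, 0 < x -> x < d -> M < y ->
        exists v, is_RInt f x y v /\ Rabs (v - L) < eps.

Definition improper_int (f : R -> Cx) (L : Cx) : Prop :=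
  improper_intR (fun t => Re (f t)) (Re L) /\
  improper_intR (fun t => Im (f t)) (Im L).

Definition abs_integrable (f : R -> Cx) : Prop :=
  exists L : R, improper_intR (fun t => Cnorm (f t)) L.

(** the value of the improper integral (meaningful when it exists) *)
Definition CInt (f : R -> Cx) : Cx :=
  epsilon (inhabits Czero) (fun L => improper_int f L).

(** * Gamma function (for Re z > 0) via Euler's integral *)
Definition CGamma (z : Cx) : Cx :=
  CInt (fun t => Cmul (Rcpow t (Csub z Cone)) (Cof (exp (- t)))).

Definition Cpartial (u : nat -> Cx) (N : nat) : Cx :=
  (sum_f_R0 (fun n => Re (u n)) N, sum_f_R0 (fun n => Im (u n)) N).
Definition Cseries_cv (u : nat -> Cx) (L : Cx) : Prop :=
  Un_cv (fun N => Re (Cpartial u N)) (Re L) /\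
  Un_cv (fun N => Im (Cpartial u N)) (Im L).
Definition Cseries (u : nat -> Cx) : Cx :=
  epsilon (inhabits Czero) (fun L => Cseries_cv u L).

Definition Phi (tau beta : R) (a c z : Cx) : Cx :=
  Cmul (Cdiv (CGamma c) (CGamma a))
    (Cseries (fun n =>
       Cmul (Cdiv (CGamma (Cadd a (Cof (tau * INR n))))
                  (CGamma (Cadd c (Cof (beta * INR n)))))
            (Cdiv (Cpown z n) (Cof (INR (fact n)))))).

Definition zeta_integrand (tau beta : R) (a c r alpha : Cx) (t : R) : Cx :=
  Cmul (Cmul (Rcpow t (Csub alpha Cone)) (Cof (exp (- t) / (1 - exp (- t)))))
       (Phi tau beta a c (Copp (Cdiv r (Cof t)))).

Definition gzeta (tau beta : R) (a c r alpha : Cx) : Cx :=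
  Cdiv (CInt (zeta_integrand tau beta a c r alpha)) (CGamma alpha).

Definition eta_integrand (tau beta : R) (a c r alpha : Cx) (t : R) : Cx :=
  Cmul (Cmul (Rcpow t (Csub alpha Cone)) (Cof (exp (- t) / (1 + exp (- t)))))
       (Phi tau beta a c (Copp (Cdiv r (Cof t)))).

(* Main.v *)
(** The substitution [t -> 2t] turns [2^(1-alpha)] times the integral for [2r]
    into twice the integral of [t^(alpha-1) exp(-2t) / (1 - exp(-2t)) Phi(-r/t)],
    and with [x = exp(-t)] one has [x/(1-x) - 2 x^2/(1-x^2) = x/(1+x)]; all the
    integrals are dominated by the one assumed to converge.

    What remains is Riemann integrability on compact intervals.  As a function
    of [s = 1/t], the series [Phi(-r/t)] is a pair of real power series, so it
    is continuous in [t] except possibly where [s] meets the smaller radius of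
    convergence.  It is locally bounded because [|Phi|] times a weight is
    Riemann integrable by hypothesis, and one discontinuity of a bounded
    function does no harm.  No asymptotics of the Gamma function are needed. *)

From Stdlib Require Import Psatz Factorial FunctionalExtensionality.
From Stdlib Require Import PropExtensionality ClassicalEpsilon.
From Coquelicot Require Import Rcomplements Rbar Hierarchy Lim_seq Series PSeries.
From Coquelicot Require Import Derive Continuity SF_seq RInt AutoDerive.
Require Import Defs.
From Stdlib Require Import Reals.
Open Scope R_scope.

(** * Riemann integrability in the presence of one discontinuity *)

(** Cauchy criterion for Riemann sums: those of [f] differ from those of [g] by at most those of
    [h], so on fine subdivisions they all cluster near the integral of [g]. *)
Lemma ex_RInt_squeeze (f : R -> R) (a b : R) : a < b ->
  (forall eps : posreal, exists (g h : R -> R) (v : R),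
     ex_RInt g a b /\ RInt.is_RInt h a b v /\ v < eps /\
     forall t, a <= t <= b -> Rabs (f t - g t) <= h t) ->
  ex_RInt f a b.
Proof.
  intros Hab H.
  assert (Hs : forall (k : R -> R) ptd,
             scal (sign (b - a)) (Riemann_sum k ptd) = Riemann_sum k ptd).
  { intros k ptd. rewrite sign_eq_1 by lra. apply Rmult_1_l. }
  apply (filterlim_locally_cauchy (F := Riemann_fine a b)
           (fun ptd => scal (sign (b - a)) (Riemann_sum f ptd))).
  intros [e He].
  (* With [v < e / 8], fine sums of [h] are below [e / 4] and fine sums of [g] are within [e / 8] of
     [w]; sums of [f] are then within [3 * e / 8 < e / 2] of [w], hence within [e] of each other. *)
  assert (He4 : 0 < e / 8) by lra.
  destruct (H (mkposreal _ He4)) as (g & h & v & [w Hg] & Hh & Hv & Hf).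
  simpl in Hv.
  pose proof (proj1 (filterlim_locally _ _) Hg (mkposreal _ He4)) as Hg'.
  pose proof (proj1 (filterlim_locally _ _) Hh (mkposreal _ He4)) as Hh'.
  assert (Hclose : Riemann_fine a b (fun ptd => Rabs (Riemann_sum f ptd - w) < e / 2)).
  { assert (Hsub : Riemann_fine a b (fun ptd =>
        pointed_subdiv ptd /\ SF_h ptd = Rmin a b /\
        seq.last (SF_h ptd) (SF_lx ptd) = Rmax a b)).
    (* Being a tagged subdivision of the interval is built into the filter, so any mesh bound
       serves. *)
    { exists (mkposreal 1 Rlt_0_1). intros; assumption. }
    generalize (filter_and _ _ Hsub (filter_and _ _ Hg' Hh')).
    apply filter_imp.
    intros ptd ((Hp & Ha & Hb) & Bg & Bh).
    rewrite Hs in Bg, Bh.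
    change (Rabs (Riemann_sum g ptd - w) < e / 8) in Bg.
    change (Rabs (Riemann_sum h ptd - v) < e / 8) in Bh.
    assert (Hn : Rabs (Riemann_sum f ptd - Riemann_sum g ptd) <= Riemann_sum h ptd).
    { pose proof (Riemann_sum_minus f g ptd) as Hm.
      change (minus (Riemann_sum f ptd) (Riemann_sum g ptd))
        with (Riemann_sum f ptd - Riemann_sum g ptd) in Hm.
      rewrite <- Hm. apply (Riemann_sum_norm (V := R_NormedModule)); [exact Hp|].
      rewrite Hb, Ha, Rmin_left, Rmax_right by lra.
      intros t Ht. apply (Hf t Ht). }
    revert Hn Bg Bh. unfold Rabs; repeat destruct Rcase_abs; lra. }
  exists (fun ptd => Rabs (Riemann_sum f ptd - w) < e / 2).
  split; [exact Hclose|].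
  intros u1 u2 H1 H2. rewrite !Hs.
  change (Rabs (Riemann_sum f u2 - Riemann_sum f u1) < e).
  revert H1 H2. unfold Rabs; repeat destruct Rcase_abs; lra.
Qed.

(** Cut out a window of half-width [d] about [t0]: replacing [f] by 0 there leaves a piecewise
    continuous function, and the error is at most [B] on the window, with integral [2 * d * B]. *)
Lemma ex_RInt_discontinuous_at_inner (f : R -> R) (a b t0 B : R) :
  a < t0 < b ->
  (forall t, a <= t <= b -> Rabs (f t) <= B) ->
  (forall t, a <= t <= b -> t <> t0 -> continuous f t) ->
  ex_RInt f a b.
Proof.
  intros Ht0 HB Hc.
  assert (HB0 : 0 <= B).
  { apply Rle_trans with (2 := HB a ltac:(lra)). apply Rabs_pos. }
  apply ex_RInt_squeeze; [lra|].
  intros [e He]. simpl.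
  (* The first bound keeps the window inside the interval, the second makes [2 * d * B < e]; [B + 1]
     guards against [B = 0]. *)
  set (d := Rmin (Rmin (t0 - a) (b - t0) / 2) (e / (4 * (B + 1)))).
  assert (Hd : 0 < d /\ d < t0 - a /\ d < b - t0 /\ d * (4 * (B + 1)) <= e).
  { assert (0 < Rmin (t0 - a) (b - t0)) by (apply Rmin_pos; lra).
    assert (0 < e / (4 * (B + 1))) by (apply Rdiv_lt_0_compat; lra).
    pose proof (Rmin_l (t0 - a) (b - t0)). pose proof (Rmin_r (t0 - a) (b - t0)).
    pose proof (Rmin_l (Rmin (t0 - a) (b - t0) / 2) (e / (4 * (B + 1)))).
    pose proof (Rmin_r (Rmin (t0 - a) (b - t0) / 2) (e / (4 * (B + 1)))).
    fold d in H3, H4.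
    assert (0 < d) by (apply Rmin_pos; lra).
    repeat split; try lra.
    apply Rle_trans with (e / (4 * (B + 1)) * (4 * (B + 1))).
    - apply Rmult_le_compat_r; lra.
    - right; field; lra. }
  destruct Hd as (Hd0 & Hda & Hdb & Hde).
  set (inside t := if Rle_dec (t0 - d) t then if Rle_dec t (t0 + d) then true else false else false).
  assert (Hin : forall t, t0 - d <= t <= t0 + d -> inside t = true).
  { intros t Ht; unfold inside; repeat destruct Rle_dec; auto; lra. }
  assert (Hout : forall t, t < t0 - d \/ t0 + d < t -> inside t = false).
  { intros t Ht; unfold inside; repeat destruct Rle_dec; auto; lra. }
  exists (fun t => if inside t then 0 else f t), (fun t => if inside t then B else 0), (2 * d * B).
  repeat split.
  (* Three pieces, on which the function is [f], 0 and [f]. Agreement is required only on open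
     pieces, so the values at [t0 - d] and [t0 + d] are harmless. *)
  - apply ex_RInt_Chasles with (t0 - d); [|apply ex_RInt_Chasles with (t0 + d)].
    + apply ex_RInt_ext with f.
      * rewrite Rmin_left, Rmax_right by lra. intros t Ht. rewrite Hout by lra; reflexivity.
      * apply (ex_RInt_continuous (V := R_CompleteNormedModule)).
        rewrite Rmin_left, Rmax_right by lra. intros; apply Hc; lra.
    + apply ex_RInt_ext with (fun _ => 0).
      * rewrite Rmin_left, Rmax_right by lra. intros t Ht. rewrite Hin by lra; reflexivity.
      * apply ex_RInt_const.
    + apply ex_RInt_ext with f.
      * rewrite Rmin_left, Rmax_right by lra. intros t Ht. rewrite Hout by lra; reflexivity.
      * apply (ex_RInt_continuous (V := R_CompleteNormedModule)).
        rewrite Rmin_left, Rmax_right by lra. intros; apply Hc; lra.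
  - replace (2 * d * B) with (plus (scal (t0 - d - a) 0)
       (plus (scal (t0 + d - (t0 - d)) B) (scal (b - (t0 + d)) 0))).
    2:{ unfold plus, scal; simpl; unfold mult; simpl; ring. }
    apply (is_RInt_Chasles (V := R_NormedModule)) with (t0 - d); [|apply (is_RInt_Chasles (V := R_NormedModule)) with (t0 + d)].
    + apply is_RInt_ext with (fun _ => 0); [|apply (is_RInt_const (V := R_NormedModule))].
      rewrite Rmin_left, Rmax_right by lra. intros t Ht. rewrite Hout by lra; reflexivity.
    + apply is_RInt_ext with (fun _ => B); [|apply (is_RInt_const (V := R_NormedModule))].
      rewrite Rmin_left, Rmax_right by lra. intros t Ht. rewrite Hin by lra; reflexivity.
    + apply is_RInt_ext with (fun _ => 0); [|apply (is_RInt_const (V := R_NormedModule))].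
      rewrite Rmin_left, Rmax_right by lra. intros t Ht. rewrite Hout by lra; reflexivity.
  - nra.
  - intros t Ht. destruct (inside t).
    + rewrite Rminus_0_r. apply HB; lra.
    + rewrite Rminus_diag, Rabs_R0; lra.
Qed.

(** Wherever [t0] lies relative to [x] and [y], a larger interval [[a, b]] contains it strictly
    inside; integrability there restricts to [[x, y]]. *)
Lemma ex_RInt_except_point (f : R -> R) (t0 x y : R) :
  0 < t0 -> 0 < x -> x < y ->
  (forall a b, 0 < a -> a < b -> exists B, forall t, a <= t <= b -> Rabs (f t) <= B) ->
  (forall t, 0 < t -> t <> t0 -> continuous f t) ->
  ex_RInt f x y.
Proof.
  intros Ht0 Hx Hxy HB Hc.
  set (a := Rmin x t0 / 2). set (b := Rmax y t0 + 1).
  assert (0 < Rmin x t0) by (apply Rmin_pos; lra).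
  pose proof (Rmin_l x t0). pose proof (Rmin_r x t0).
  pose proof (Rmax_l y t0). pose proof (Rmax_r y t0).
  assert (Hab : 0 < a /\ a < x /\ a < t0 /\ y < b /\ t0 < b) by (unfold a, b; lra).
  destruct (HB a b) as [B HB']; [lra..|].
  apply (ex_RInt_Chasles_2 (V := R_CompleteNormedModule)) with a; [lra|].
  apply (ex_RInt_Chasles_1 (V := R_CompleteNormedModule)) with b; [lra|].
  apply ex_RInt_discontinuous_at_inner with t0 B; [lra|exact HB'|].
  intros t Ht Hne; apply Hc; lra.
Qed.

(** * Improper integrals of real functions over the positive half-line *)

Lemma is_RInt_Defs (f : R -> R) (x y v : R) :
  Defs.is_RInt f x y v <-> RInt.is_RInt f x y v.
Proof.
  split.
  - intros [pr <-]. rewrite <- (RInt_Reals f x y pr).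
    apply (RInt_correct (V := R_CompleteNormedModule)), ex_RInt_Reals_1; exact pr.
  - intros H. assert (pr : Riemann_integrable f x y).
    { apply ex_RInt_Reals_0; exists v; exact H. }
    exists pr. rewrite <- RInt_Reals. apply (is_RInt_unique (V := R_CompleteNormedModule)); exact H.
Qed.

Lemma improper_intR_near (f : R -> R) (L eps : R) :
  improper_intR f L -> 0 < eps ->
  exists d M, 0 < d /\ d <= M /\
    forall x y, 0 < x -> x < d -> M < y -> Rabs (RInt f x y - L) < eps.
Proof.
  intros H He. destruct (H eps He) as (d & M & Hd & HM & H').
  exists d, M; repeat split; auto. intros x y Hx Hxd HMy.
  destruct (H' x y Hx Hxd HMy) as (v & Hv & Hlt).
  apply is_RInt_Defs, (is_RInt_unique (V := R_CompleteNormedModule)) in Hv. rewrite Hv; exact Hlt.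
Qed.

(** Convergence gives integrability only on intervals reaching below [d] and beyond [M]; every other
    compact interval sits inside such a one. *)
Lemma improper_intR_ex_RInt (f : R -> R) (L x y : R) :
  improper_intR f L -> 0 < x -> x <= y -> ex_RInt f x y.
Proof.
  intros H Hx Hxy. destruct (H 1 Rlt_0_1) as (d & M & Hd & HM & H').
  set (a := Rmin x d / 2). set (b := Rmax y M + 1).
  assert (0 < Rmin x d) by (apply Rmin_pos; lra).
  pose proof (Rmin_l x d). pose proof (Rmin_r x d).
  pose proof (Rmax_l y M). pose proof (Rmax_r y M).
  assert (Hab : 0 < a /\ a < d /\ a < x /\ M < b /\ y < b) by (unfold a, b; lra).
  destruct (H' a b) as (v & Hv & _); try lra.
  apply is_RInt_Defs in Hv.
  apply (ex_RInt_Chasles_2 (V := R_CompleteNormedModule)) with a; [lra|].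
  apply (ex_RInt_Chasles_1 (V := R_CompleteNormedModule)) with b; [lra|].
  exists v; exact Hv.
Qed.

Lemma improper_intR_intro (f : R -> R) (L : R) :
  (forall x y, 0 < x -> x < y -> ex_RInt f x y) ->
  (forall eps, 0 < eps -> exists d M, 0 < d /\ d <= M /\
     forall x y, 0 < x -> x < d -> M < y -> Rabs (RInt f x y - L) < eps) ->
  improper_intR f L.
Proof.
  intros Hex H eps He. destruct (H eps He) as (d & M & Hd & HM & H').
  exists d, M; repeat split; auto. intros x y Hx Hxd HMy.
  exists (RInt f x y); split; [|apply H'; auto].
  apply is_RInt_Defs, (RInt_correct (V := R_CompleteNormedModule)), Hex; lra.
Qed.

Lemma improper_intR_unique (f : R -> R) (L K : R) :
  improper_intR f L -> improper_intR f K -> L = K.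
Proof.
  intros HL HK. apply cond_eq. intros eps He.
  destruct (improper_intR_near f L (eps / 2) HL ltac:(lra)) as (d & M & Hd & HM & H1).
  destruct (improper_intR_near f K (eps / 2) HK ltac:(lra)) as (d' & M' & Hd' & HM' & H2).
  pose proof (Rmin_pos d d' Hd Hd').
  pose proof (Rmin_l d d'). pose proof (Rmin_r d d').
  pose proof (Rmax_l M M'). pose proof (Rmax_r M M').
  specialize (H1 (Rmin d d' / 2) (Rmax M M' + 1) ltac:(lra) ltac:(lra) ltac:(lra)).
  specialize (H2 (Rmin d d' / 2) (Rmax M M' + 1) ltac:(lra) ltac:(lra) ltac:(lra)).
  revert H1 H2. unfold Rabs; repeat destruct Rcase_abs; lra.
Qed.

Lemma improper_intR_ext (f g : R -> R) (L : R) :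
  (forall t, 0 < t -> f t = g t) -> improper_intR f L -> improper_intR g L.
Proof.
  intros E H.
  assert (E' : forall x y, 0 < x -> x < y -> forall t, Rmin x y < t < Rmax x y -> f t = g t).
  { intros x y Hx Hxy t. rewrite Rmin_left, Rmax_right by lra. intros; apply E; lra. }
  apply improper_intR_intro.
  - intros x y Hx Hxy. apply ex_RInt_ext with f; [intros; apply (E' x y); auto|].
    apply improper_intR_ex_RInt with L; auto; lra.
  - intros eps He. destruct (improper_intR_near f L eps H He) as (d & M & Hd & HM & H').
    exists d, M; repeat split; auto. intros x y Hx Hxd HMy.
    rewrite <- (RInt_ext f g x y); [apply H'; auto|apply (E' x y); lra].
Qed.

Lemma improper_intR_lincomb (f g : R -> R) (k l L K : R) :
  improper_intR f L -> improper_intR g K ->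
  improper_intR (fun t => k * f t + l * g t) (k * L + l * K).
Proof.
  intros HL HK.
  assert (HI : forall x y, 0 < x -> x < y ->
    RInt.is_RInt (fun t => k * f t + l * g t) x y (k * RInt f x y + l * RInt g x y)).
  { intros x y Hx Hxy.
    apply (is_RInt_plus (V := R_NormedModule) (fun t => k * f t) (fun t => l * g t));
      apply (is_RInt_scal (V := R_NormedModule));
      apply (RInt_correct (V := R_CompleteNormedModule));
      eapply improper_intR_ex_RInt; eauto; lra. }
  apply improper_intR_intro.
  - intros x y Hx Hxy. eexists; apply HI; auto.
  - intros eps He.
    (* The summand 1 keeps the denominator positive when both coefficients vanish and makes the
       final inequality strict. *)
    set (e := eps / (Rabs k + Rabs l + 1)).
    pose proof (Rabs_pos k). pose proof (Rabs_pos l).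
    assert (0 < e) by (apply Rdiv_lt_0_compat; lra).
    assert (Hee : e * (Rabs k + Rabs l + 1) = eps) by (unfold e; field; lra).
    destruct (improper_intR_near f L e HL ltac:(lra)) as (d & M & Hd & HM & H3).
    destruct (improper_intR_near g K e HK ltac:(lra)) as (d' & M' & Hd' & HM' & H4).
    pose proof (Rmin_pos d d' Hd Hd').
    pose proof (Rmin_l d d'). pose proof (Rmin_r d d').
    pose proof (Rmax_l M M'). pose proof (Rmax_r M M').
    exists (Rmin d d'), (Rmax M M'); repeat split; [lra..|].
    intros x y Hx Hxd HMy.
    rewrite (is_RInt_unique (V := R_CompleteNormedModule) _ _ _ _ (HI x y ltac:(lra) ltac:(lra))).
    specialize (H3 x y ltac:(lra) ltac:(lra) ltac:(lra)).
    specialize (H4 x y ltac:(lra) ltac:(lra) ltac:(lra)).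
    replace (k * RInt f x y + l * RInt g x y - (k * L + l * K))
      with (k * (RInt f x y - L) + l * (RInt g x y - K)) by ring.
    apply Rle_lt_trans with (1 := Rabs_triang _ _). rewrite !Rabs_mult. nra.
Qed.

Lemma improper_intR_dilate (f : R -> R) (k L : R) :
  0 < k -> improper_intR f L -> improper_intR (fun t => f (k * t)) (L / k).
Proof.
  intros Hk H.
  assert (HI : forall x y, 0 < x -> x < y ->
    RInt.is_RInt (fun t => f (k * t)) x y (RInt f (k * x) (k * y) / k)).
  { intros x y Hx Hxy.
    (* Puts the integrand into the shape of the affine substitution rule, with Jacobian [k] and
       shift 0. *)
    apply is_RInt_ext with (fun t => / k * (k * f (k * t + 0))).
    { intros t _. rewrite Rplus_0_r. change (/ k * (k * f (k * t)) = f (k * t)). field; lra. }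
    replace (RInt f (k * x) (k * y) / k) with (/ k * RInt f (k * x + 0) (k * y + 0)).
    2:{ rewrite !Rplus_0_r. field; lra. }
    apply (is_RInt_scal (V := R_NormedModule)).
    apply (is_RInt_comp_lin (V := R_NormedModule)).
    apply (RInt_correct (V := R_CompleteNormedModule)).
    rewrite !Rplus_0_r. apply improper_intR_ex_RInt with L; auto; nra. }
  apply improper_intR_intro.
  - intros x y Hx Hxy. eexists; apply HI; auto.
  - intros eps He.
    destruct (improper_intR_near f L (eps * k) H ltac:(nra)) as (d & M & Hd & HM & H').
    exists (d / k), (M / k).
    assert (Hd' : k * (d / k) = d) by (field; lra).
    assert (HM' : k * (M / k) = M) by (field; lra).
    repeat split; [apply Rdiv_lt_0_compat; lra|nra|].
    intros x y Hx Hxd HMy.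
    rewrite (is_RInt_unique (V := R_CompleteNormedModule) _ _ _ _ (HI x y ltac:(lra) ltac:(nra))).
    specialize (H' (k * x) (k * y) ltac:(nra) ltac:(nra) ltac:(nra)).
    replace (RInt f (k * x) (k * y) / k - L / k) with ((RInt f (k * x) (k * y) - L) / k)
      by (field; lra).
    unfold Rdiv; rewrite Rabs_mult, (Rabs_pos_eq (/ k)).
    2:{ left; apply Rinv_0_lt_compat; lra. }
    apply Rmult_lt_reg_r with k; [lra|].
    rewrite Rmult_assoc, Rinv_l, Rmult_1_r by lra. exact H'.
Qed.

Lemma RInt_nonneg_mono (f : R -> R) (x y x' y' : R) :
  (forall t, 0 < t -> 0 <= f t) ->
  (forall x y, 0 < x -> x < y -> ex_RInt f x y) ->
  0 < x' -> x' <= x -> x < y -> y <= y' -> RInt f x y <= RInt f x' y'.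
Proof.
  intros Hf Hex Hx' Hxx Hxy Hyy.
  assert (Hex' : forall x y, 0 < x -> x <= y -> ex_RInt f x y).
  { intros u v Hu [Huv| ->]; [auto|apply ex_RInt_point]. }
  rewrite <- (RInt_Chasles (V := R_CompleteNormedModule) f x' x y') by (apply Hex'; lra).
  rewrite <- (RInt_Chasles (V := R_CompleteNormedModule) f x y y') by (apply Hex'; lra).
  assert (0 <= RInt f x' x) by (apply RInt_ge_0; [lra|apply Hex'; lra|intros; apply Hf; lra]).
  assert (0 <= RInt f y y') by (apply RInt_ge_0; [lra|apply Hex'; lra|intros; apply Hf; lra]).
  unfold plus; simpl; lra.
Qed.

(** For a nonnegative function the integral grows with the interval, so the limit is the supremum
    over all compact intervals. *)
Lemma improper_intR_of_bounded (f : R -> R) (B : R) :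
  (forall t, 0 < t -> 0 <= f t) ->
  (forall x y, 0 < x -> x < y -> ex_RInt f x y) ->
  (forall x y, 0 < x -> x < y -> RInt f x y <= B) ->
  exists L, improper_intR f L.
Proof.
  intros Hf Hex HB.
  destruct (completeness (fun v => exists x y, 0 < x /\ x < y /\ v = RInt f x y)) as [L [HL1 HL2]].
  - exists B. intros v (x & y & Hx & Hxy & ->); auto.
  - exists (RInt f 1 2), 1, 2; repeat split; lra.
  - exists L. apply improper_intR_intro; [exact Hex|]. intros eps He.
    (* An interval whose integral comes within [eps] of the supremum supplies the thresholds: its
       endpoints serve as [d] and [M]. *)
    destruct (Classical_Prop.classic (exists x y, 0 < x /\ x < y /\ L - eps < RInt f x y))
      as [(x0 & y0 & Hx0 & Hxy0 & H0)|Hno].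
    + exists x0, y0; repeat split; [lra..|]. intros x y Hx Hxd HMy.
      assert (RInt f x0 y0 <= RInt f x y) by (apply RInt_nonneg_mono; auto; lra).
      assert (RInt f x y <= L) by (apply HL1; exists x, y; repeat split; lra).
      unfold Rabs; destruct Rcase_abs; lra.
    + exfalso. assert (L <= L - eps); [|lra].
      apply HL2. intros v (x & y & Hx & Hxy & ->).
      apply Rnot_lt_le. intro Hlt. apply Hno. exists x, y; auto.
Qed.

(** Writes [f] as [(f + g) - g]: the sum [f + g] is nonnegative with bounded integrals, so the
    monotone case applies without splitting [f] into positive and negative parts. *)
Lemma improper_intR_dominated (f g : R -> R) (K : R) :
  (forall x y, 0 < x -> x < y -> ex_RInt f x y) ->
  (forall t, 0 < t -> Rabs (f t) <= g t) ->
  improper_intR g K ->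
  exists L, improper_intR f L.
Proof.
  intros Hex Hfg HK.
  assert (Hgex : forall x y, 0 < x -> x < y -> ex_RInt g x y).
  { intros; apply improper_intR_ex_RInt with K; auto; lra. }
  assert (Hg0 : forall t, 0 < t -> 0 <= g t).
  { intros t Ht. apply Rle_trans with (2 := Hfg t Ht), Rabs_pos. }
  (* Convergence with tolerance 1 bounds the integral over one large interval containing [[x, y]],
     and [g] is nonnegative. *)
  assert (HgB : forall x y, 0 < x -> x < y -> RInt g x y <= K + 1).
  { intros x y Hx Hxy.
    destruct (improper_intR_near g K 1 HK Rlt_0_1) as (d & M & Hd & HM & H).
    pose proof (Rmin_pos x d Hx Hd).
    pose proof (Rmin_l x d). pose proof (Rmin_r x d).
    pose proof (Rmax_l y M). pose proof (Rmax_r y M).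
    specialize (H (Rmin x d / 2) (Rmax y M + 1) ltac:(lra) ltac:(lra) ltac:(lra)).
    assert (RInt g x y <= RInt g (Rmin x d / 2) (Rmax y M + 1))
      by (apply RInt_nonneg_mono; auto; lra).
    revert H; unfold Rabs; destruct Rcase_abs; lra. }
  assert (Hsum : forall x y, 0 < x -> x < y ->
    RInt.is_RInt (fun t => f t + g t) x y (RInt f x y + RInt g x y)).
  { intros x y Hx Hxy. apply (is_RInt_plus (V := R_NormedModule));
      apply (RInt_correct (V := R_CompleteNormedModule)); auto. }
  destruct (improper_intR_of_bounded (fun t => f t + g t) (2 * (K + 1))) as [L HL].
  - intros t Ht. specialize (Hfg t Ht). revert Hfg; unfold Rabs; destruct Rcase_abs; lra.
  - intros x y Hx Hxy; eexists; apply Hsum; auto.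
  - intros x y Hx Hxy. rewrite (is_RInt_unique (V := R_CompleteNormedModule) _ _ _ _ (Hsum x y Hx Hxy)).
    assert (RInt f x y <= RInt g x y).
    { apply RInt_le; auto; [lra|]. intros t Ht.
      apply Rle_trans with (1 := Rle_abs _), Hfg; lra. }
    specialize (HgB x y Hx Hxy). lra.
  - exists (1 * L + -1 * K).
    apply improper_intR_ext with (fun t => 1 * (f t + g t) + -1 * g t).
    + intros; ring.
    + apply improper_intR_lincomb; auto.
Qed.

(** A Riemann integrable function is bounded, so [g] supplies the local bounds on [f] that make its
    one possible discontinuity harmless. *)
Lemma improper_intR_dominated_except_point (f g : R -> R) (t0 K : R) :
  0 < t0 ->
  (forall t, 0 < t -> t <> t0 -> continuous f t) ->
  (forall t, 0 < t -> Rabs (f t) <= g t) ->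
  improper_intR g K ->
  exists L, improper_intR f L.
Proof.
  intros Ht0 Hc Hfg HK. apply improper_intR_dominated with g K; auto.
  intros x y Hx Hxy. apply ex_RInt_except_point with t0; auto.
  intros a b Ha Hab.
  destruct (ex_RInt_ub (V := R_NormedModule) g a b) as [B HB].
  { apply improper_intR_ex_RInt with K; auto; lra. }
  rewrite Rmin_left, Rmax_right in HB by lra.
  exists B. intros t Ht. apply Rle_trans with (1 := Hfg t ltac:(lra)).
  apply Rle_trans with (2 := HB t Ht), Rle_abs.
Qed.

(** * Sums of complex series and real power series *)

Lemma Cseries_unique (u : nat -> Cx) (L : Cx) : Cseries_cv u L -> Cseries u = L.
Proof.
  intros H.
  assert (H' : Cseries_cv u (Cseries u)) by (exact (epsilon_spec (inhabits Czero) (Cseries_cv u) (ex_intro _ L H))).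
  destruct H as [H1 H2], H' as [H3 H4].
  rewrite (surjective_pairing (Cseries u)), (surjective_pairing L).
  f_equal; eapply UL_sequence; eauto.
Qed.

(** By extensionality the convergence predicate of a divergent series equals the empty predicate, so
    all divergent series receive one and the same default value. *)
Lemma Cseries_divergent (u : nat -> Cx) :
  (forall L, ~ Cseries_cv u L) ->
  Cseries u = epsilon (inhabits Czero) (fun _ => False).
Proof.
  intros H. unfold Cseries. f_equal.
  apply functional_extensionality; intros L.
  apply propositional_extensionality; split; [apply H|contradiction].
Qed.

Lemma Un_cv_pseries (p : nat -> R) (s : R) :
  Rbar_lt (Rabs s) (CV_radius p) ->
  Un_cv (sum_f_R0 (fun n => p n * s ^ n)) (PSeries p s).
Proof.
  intros H. apply CV_radius_inside in H.
  apply is_lim_seq_Reals.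
  apply PSeries_correct, is_pseries_R, is_series_Reals, is_lim_seq_Reals in H.
  exact H.
Qed.

Lemma pseries_not_Un_cv (p : nat -> R) (s l : R) :
  Rbar_lt (CV_radius p) (Rabs s) -> ~ Un_cv (sum_f_R0 (fun n => p n * s ^ n)) l.
Proof.
  intros H Hl. apply (CV_disk_outside p s H).
  apply ex_series_lim_0. exists l. apply is_series_Reals. exact Hl.
Qed.

(** Only a finite positive [m] can be met by a positive [s]; otherwise the excluded point is
    arbitrary and 1 is taken. *)
Lemma Rbar_dichotomy_except_point (m : Rbar) :
  exists s0 : R, 0 < s0 /\ forall s : R, 0 < s -> s <> s0 -> Rbar_lt s m \/ Rbar_lt m s.
Proof.
  destruct m as [m| |].
  - destruct (Rlt_dec 0 m) as [Hm|Hm].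
    + exists m; split; [exact Hm|]. intros s _ Hs. simpl. lra.
    + exists 1; split; [lra|]. intros s Hs _. right; simpl; lra.
  - exists 1; split; [lra|]. intros s _ _; left; exact I.
  - exists 1; split; [lra|]. intros s _ _; right; exact I.
Qed.

(* Beyond the smaller of the two radii of convergence, [Cseries] is [epsilon] of the empty predicate, hence constant. *)
Lemma Cseries_powers_continuous_except_point (p q : nat -> R) :
  exists s0, 0 < s0 /\ forall s, 0 < s -> s <> s0 ->
    continuous (fun s => Re (Cseries (fun n => (p n * s ^ n, q n * s ^ n)))) s /\
    continuous (fun s => Im (Cseries (fun n => (p n * s ^ n, q n * s ^ n)))) s.
Proof.
  set (m := Rbar_min (CV_radius p) (CV_radius q)).
  destruct (Rbar_dichotomy_except_point m) as (s0 & Hs0 & Hd).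
  exists s0; split; [exact Hs0|]. intros s Hs Hne.
  assert (Hpos : locally s (fun x => 0 < x)).
  { apply (open_gt 0 s Hs). }
  destruct (Hd s Hs Hne) as [Hlt|Hgt].
  - assert (Hin : forall x, 0 < x -> Rbar_lt x m ->
              Rbar_lt (Rabs x) (CV_radius p) /\ Rbar_lt (Rabs x) (CV_radius q)).
    { intros x Hx Hxm. rewrite Rabs_pos_eq by lra.
      split; apply Rbar_lt_le_trans with m; auto; [apply Rbar_min_l|apply Rbar_min_r]. }
    assert (Hv : locally s (fun x =>
       (PSeries p x, PSeries q x) = Cseries (fun n => (p n * x ^ n, q n * x ^ n)))).
    { generalize (filter_and _ _ Hpos (open_Rbar_lt m s Hlt)). apply filter_imp.
      intros x [Hx Hxm]. symmetry. apply Cseries_unique.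
      destruct (Hin x Hx Hxm). split; apply Un_cv_pseries; assumption. }
    destruct (Hin s Hs Hlt) as [Hp Hq].
    split.
    + apply continuous_ext_loc with (PSeries p).
      * revert Hv; apply filter_imp. intros x <-; reflexivity.
      * apply continuity_pt_filterlim, PSeries_continuity, Hp.
    + apply continuous_ext_loc with (PSeries q).
      * revert Hv; apply filter_imp. intros x <-; reflexivity.
      * apply continuity_pt_filterlim, PSeries_continuity, Hq.
  - assert (Hv : locally s (fun x => epsilon (inhabits Czero) (fun _ => False)
                  = Cseries (fun n => (p n * x ^ n, q n * x ^ n)))).
    { generalize (filter_and _ _ Hpos (open_Rbar_gt m s Hgt)). apply filter_imp.
      intros x [Hx Hxm]. symmetry. apply Cseries_divergent. intros L [H1 H2].
      rewrite <- (Rabs_pos_eq x) in Hxm by lra. unfold m in Hxm.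
      (* Whichever radius is the minimum, the corresponding component diverges at [x], and that
         already excludes convergence of the complex series. *)
      destruct (Rbar_min_case (CV_radius p) (CV_radius q)
        (fun k => k = CV_radius p \/ k = CV_radius q)) as [E|E]; auto; rewrite E in Hxm.
      - exact (pseries_not_Un_cv _ _ _ Hxm H1).
      - exact (pseries_not_Un_cv _ _ _ Hxm H2). }
    split.
    + apply continuous_ext_loc with (fun _ => Re (epsilon (inhabits Czero) (fun _ => False))).
      * revert Hv; apply filter_imp. intros x <-; reflexivity.
      * apply continuous_const.
    + apply continuous_ext_loc with (fun _ => Im (epsilon (inhabits Czero) (fun _ => False))).
      * revert Hv; apply filter_imp. intros x <-; reflexivity.
      * apply continuous_const.
Qed.

(** * Continuity of the hypergeometric factor in [t] *)

Lemma Cx_eq (z w : Cx) : Re z = Re w -> Im z = Im w -> z = w.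
Proof. destruct z, w; unfold Re, Im; simpl; intros -> ->; reflexivity. Qed.

Lemma Cdiv_Cof (z : Cx) (x : R) : x <> 0 -> Cdiv z (Cof x) = (Re z / x, Im z / x).
Proof.
  intros Hx. apply Cx_eq; unfold Cdiv, Cmul, Cinv, Cof, Re, Im; simpl; field; auto.
Qed.

(** Separates the real parameter from a fixed complex direction: along a ray, a complex power series
    becomes a pair of real ones. *)
Lemma Cpown_real_scale (s : R) (w : Cx) (n : nat) :
  Cpown (s * Re w, s * Im w) n = (s ^ n * Re (Cpown w n), s ^ n * Im (Cpown w n)).
Proof.
  induction n as [|n IH]; simpl.
  - apply Cx_eq; unfold Cone, Re, Im; simpl; ring.
  - rewrite IH. apply Cx_eq; unfold Cmul, Re, Im; simpl; ring.
Qed.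

Definition Ccontinuous (f : R -> Cx) (t : R) : Prop :=
  continuous (fun t => Re (f t)) t /\ continuous (fun t => Im (f t)) t.

(** The argument [-r/t] is [-r] scaled by the real number [s = 1/t]. Absorbing the powers of [-r]
    into coefficients [k n] leaves two real power series in [s], and the exceptional [s0]
    corresponds to [t0 = 1/s0]. *)
Lemma Phi_continuous_except_point (tau beta : R) (a c r : Cx) :
  exists t0, 0 < t0 /\ forall t, 0 < t -> t <> t0 ->
    Ccontinuous (fun t => Phi tau beta a c (Copp (Cdiv r (Cof t)))) t.
Proof.
  set (b n := Cdiv (CGamma (Cadd a (Cof (tau * INR n)))) (CGamma (Cadd c (Cof (beta * INR n))))).
  set (k n := Cmul (b n) (Cdiv (Cpown (Copp r) n) (Cof (INR (fact n))))).
  set (S s := Cseries (fun n => (Re (k n) * s ^ n, Im (k n) * s ^ n))).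
  destruct (Cseries_powers_continuous_except_point (fun n => Re (k n)) (fun n => Im (k n)))
    as (s0 & Hs0 & Hc).
  set (G := Cdiv (CGamma c) (CGamma a)).
  assert (HPhi : forall t, 0 < t ->
     Cmul G (S (/ t)) = Phi tau beta a c (Copp (Cdiv r (Cof t)))).
  { intros t Ht. unfold Phi. fold G. f_equal. unfold S. f_equal.
    apply functional_extensionality. intros n. fold (b n).
    pose proof (INR_fact_neq_0 n).
    unfold k. generalize (b n); intros bn. rewrite !Cdiv_Cof by (auto; lra).
    replace (Copp (Re r / t, Im r / t)) with (/ t * Re (Copp r), / t * Im (Copp r)).
    2:{ apply Cx_eq; unfold Copp, Re, Im; simpl; field; lra. }
    rewrite Cpown_real_scale.
    apply Cx_eq; unfold Cmul, Re, Im; simpl; field; lra. }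
  exists (/ s0); split; [apply Rinv_0_lt_compat; lra|].
  intros t Ht Hne.
  assert (Hpos : locally t (fun x => 0 < x)) by apply (open_gt 0 t Ht).
  assert (Hinv : continuous Rinv t).
  { apply (ex_derive_continuous (V := R_NormedModule)); auto_derive; lra. }
  destruct (Hc (/ t)) as [HR HI].
  { apply Rinv_0_lt_compat; lra. }
  { intros E. apply Hne. rewrite <- E, Rinv_inv; reflexivity. }
  pose proof (continuous_comp _ _ t Hinv HR) as HR'.
  pose proof (continuous_comp _ _ t Hinv HI) as HI'.
  split.
  - apply continuous_ext_loc with
      (fun x => minus (scal (Re G) (Re (S (/ x)))) (scal (Im G) (Im (S (/ x))))).
    + revert Hpos; apply filter_imp; intros x Hx. rewrite <- HPhi by exact Hx. reflexivity.
    + apply (continuous_minus (V := R_NormedModule));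
      apply (continuous_scal_r (V := R_NormedModule)); assumption.
  - apply continuous_ext_loc with
      (fun x => plus (scal (Re G) (Im (S (/ x)))) (scal (Im G) (Re (S (/ x))))).
    + revert Hpos; apply filter_imp; intros x Hx. rewrite <- HPhi by exact Hx. reflexivity.
    + apply (continuous_plus (V := R_NormedModule));
      apply (continuous_scal_r (V := R_NormedModule)); assumption.
Qed.

(** * Improper integrals of complex functions *)

Lemma improper_int_unique (f : R -> Cx) (L K : Cx) :
  improper_int f L -> improper_int f K -> L = K.
Proof. intros [] []. apply Cx_eq; eapply improper_intR_unique; eauto. Qed.

Lemma CInt_eq (f : R -> Cx) (L : Cx) : improper_int f L -> CInt f = L.
Proof.
  intros H. apply improper_int_unique with f; [|exact H].
  exact (epsilon_spec (inhabits Czero) (improper_int f) (ex_intro _ L H)).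
Qed.

Lemma improper_int_ext (f g : R -> Cx) (L : Cx) :
  (forall t, 0 < t -> f t = g t) -> improper_int f L -> improper_int g L.
Proof.
  intros E []. split; eapply improper_intR_ext; eauto; intros t Ht; simpl; rewrite E; auto.
Qed.

Lemma improper_int_sub (f g : R -> Cx) (L K : Cx) :
  improper_int f L -> improper_int g K ->
  improper_int (fun t => Csub (f t) (g t)) (Csub L K).
Proof.
  intros [] [].
  split; [replace (Re (Csub L K)) with (1 * Re L + -1 * Re K)
         |replace (Im (Csub L K)) with (1 * Im L + -1 * Im K)];
    try (unfold Csub, Cadd, Copp, Re, Im; simpl; ring);
    (eapply improper_intR_ext; [|apply improper_intR_lincomb; eassumption]);
    intros; unfold Csub, Cadd, Copp, Re, Im; simpl; ring.
Qed.

(** Each component of the product with a constant is a real linear combination of the two components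
    of [f]. *)
Lemma improper_int_mul (f : R -> Cx) (k L : Cx) :
  improper_int f L -> improper_int (fun t => Cmul k (f t)) (Cmul k L).
Proof.
  intros [].
  split; [replace (Re (Cmul k L)) with (Re k * Re L + - Im k * Im L)
         |replace (Im (Cmul k L)) with (Im k * Re L + Re k * Im L)];
    try (unfold Cmul, Re, Im; simpl; ring);
    (eapply improper_intR_ext; [|apply improper_intR_lincomb; eassumption]);
    intros; unfold Cmul, Re, Im; simpl; ring.
Qed.

Lemma improper_int_dilate (f : R -> Cx) (k : R) (L : Cx) : 0 < k ->
  improper_int f L -> improper_int (fun t => f (k * t)) (Cdiv L (Cof k)).
Proof.
  intros Hk [H1 H2]. rewrite Cdiv_Cof by lra.
  split; [exact (improper_intR_dilate _ k _ Hk H1)|exact (improper_intR_dilate _ k _ Hk H2)].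
Qed.

(** * Modulus, complex powers of reals, and continuity *)

Lemma Cnorm_mul (z w : Cx) : Cnorm (Cmul z w) = Cnorm z * Cnorm w.
Proof.
  unfold Cnorm. rewrite <- sqrt_mult by nra. f_equal.
  unfold Cmul, Re, Im; simpl; ring.
Qed.

Lemma Cnorm_Cof (x : R) : Cnorm (Cof x) = Rabs x.
Proof. unfold Cnorm, Cof, Re, Im; simpl. rewrite <- sqrt_Rsqr_abs. f_equal. unfold Rsqr; ring. Qed.

Lemma Cnorm_Rcpow (t : R) (z : Cx) : Cnorm (Rcpow t z) = Rpower t (Re z).
Proof.
  unfold Rcpow, Cexp, Cnorm, Rpower.
  replace (Re (Cmul z (Cof (ln t)))) with (Re z * ln t)
    by (unfold Cmul, Cof, Re, Im; simpl; ring).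
  generalize (Im (Cmul z (Cof (ln t)))); intros y.
  unfold Re at 1, Im at 1; simpl fst; simpl snd.
  replace ((exp (Re z * ln t) * cos y) ^ 2 + (exp (Re z * ln t) * sin y) ^ 2)
    with (Rsqr (exp (Re z * ln t)) * (Rsqr (sin y) + Rsqr (cos y)))
    by (unfold Rsqr; ring).
  rewrite sin2_cos2, Rmult_1_r, sqrt_Rsqr; [reflexivity|left; apply exp_pos].
Qed.

Lemma Rcpow_mult (s t : R) (z : Cx) : 0 < s -> 0 < t ->
  Rcpow (s * t) z = Cmul (Rcpow s z) (Rcpow t z).
Proof.
  intros Hs Ht. unfold Rcpow, Cexp. rewrite ln_mult by assumption.
  replace (Re (Cmul z (Cof (ln s + ln t))))
    with (Re (Cmul z (Cof (ln s))) + Re (Cmul z (Cof (ln t))))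
    by (unfold Cmul, Cof, Re, Im; simpl; ring).
  replace (Im (Cmul z (Cof (ln s + ln t))))
    with (Im (Cmul z (Cof (ln s))) + Im (Cmul z (Cof (ln t))))
    by (unfold Cmul, Cof, Re, Im; simpl; ring).
  rewrite exp_plus, cos_plus, sin_plus.
  apply Cx_eq; unfold Cmul, Re, Im; simpl; ring.
Qed.

Lemma Rcpow_opp_mul (s : R) (z : Cx) : Cmul (Rcpow s (Csub Cone z)) (Rcpow s (Csub z Cone)) = Cone.
Proof.
  unfold Rcpow, Cexp.
  replace (Re (Cmul (Csub Cone z) (Cof (ln s)))) with (- Re (Cmul (Csub z Cone) (Cof (ln s))))
    by (unfold Cmul, Csub, Cadd, Copp, Cone, Cof, Re, Im; simpl; ring).
  replace (Im (Cmul (Csub Cone z) (Cof (ln s)))) with (- Im (Cmul (Csub z Cone) (Cof (ln s))))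
    by (unfold Cmul, Csub, Cadd, Copp, Cone, Cof, Re, Im; simpl; ring).
  set (x := Re _). set (y := Im _).
  rewrite cos_neg, sin_neg.
  pose proof (sin2_cos2 y) as Hsc. unfold Rsqr in Hsc.
  assert (He : exp (- x) * exp x = 1) by (rewrite <- exp_plus, Rplus_opp_l; apply exp_0).
  apply Cx_eq; unfold Cmul, Cone, Re, Im; simpl.
  - transitivity (exp (- x) * exp x * (sin y * sin y + cos y * cos y)); [ring|].
    rewrite He, Hsc; ring.
  - ring.
Qed.

Lemma Ccontinuous_mul (f g : R -> Cx) (t : R) :
  Ccontinuous f t -> Ccontinuous g t -> Ccontinuous (fun t => Cmul (f t) (g t)) t.
Proof.
  intros [H1 H2] [H3 H4]. split.
  - apply (continuous_minus (V := R_NormedModule) (fun t => Re (f t) * Re (g t))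
             (fun t => Im (f t) * Im (g t)));
      apply (continuous_mult (K := R_AbsRing)); assumption.
  - apply (continuous_plus (V := R_NormedModule) (fun t => Re (f t) * Im (g t))
             (fun t => Im (f t) * Re (g t)));
      apply (continuous_mult (K := R_AbsRing)); assumption.
Qed.

Lemma Ccontinuous_Cof (w : R -> R) (t : R) :
  ex_derive w t -> Ccontinuous (fun t => Cof (w t)) t.
Proof.
  intros Hw. split; [|apply continuous_const].
  exact (ex_derive_continuous (V := R_NormedModule) w t Hw).
Qed.

Lemma Ccontinuous_Rcpow (z : Cx) (t : R) : 0 < t -> Ccontinuous (fun t => Rcpow t z) t.
Proof.
  intros Ht. unfold Ccontinuous, Rcpow, Cexp, Cmul, Cof, Re, Im; simpl.
  split; apply (ex_derive_continuous (V := R_NormedModule)); auto_derive; auto.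
Qed.

Lemma continuous_Cnorm (f : R -> Cx) (t : R) :
  Ccontinuous f t -> continuous (fun t => Cnorm (f t)) t.
Proof.
  intros [H1 H2]. unfold Cnorm.
  apply (continuous_comp (fun t => Re (f t) ^ 2 + Im (f t) ^ 2) sqrt).
  - assert (Hsq : forall g : R -> R, continuous g t -> continuous (fun t => g t ^ 2) t).
    { intros g Hg. apply (continuous_comp g (fun x => x ^ 2)); [exact Hg|].
      apply (ex_derive_continuous (V := R_NormedModule)); auto_derive; auto. }
    exact (continuous_plus (V := R_NormedModule) _ _ _ (Hsq _ H1) (Hsq _ H2)).
  - apply continuity_pt_filterlim, continuity_pt_sqrt. nra.
Qed.

Lemma Rabs_Re_le (z : Cx) : Rabs (Re z) <= Cnorm z.
Proof.
  rewrite <- sqrt_Rsqr_abs. apply sqrt_le_1_alt. unfold Rsqr. nra.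
Qed.

Lemma Rabs_Im_le (z : Cx) : Rabs (Im z) <= Cnorm z.
Proof.
  rewrite <- sqrt_Rsqr_abs. apply sqrt_le_1_alt. unfold Rsqr. nra.
Qed.

(** The modulus dominates both components and is itself continuous wherever [f] is, so real
    domination by [g] applies three times. *)
Lemma improper_int_dominated_except_point (f : R -> Cx) (g : R -> R) (t0 K : R) :
  0 < t0 ->
  (forall t, 0 < t -> t <> t0 -> Ccontinuous f t) ->
  (forall t, 0 < t -> Cnorm (f t) <= g t) ->
  improper_intR g K ->
  (exists L, improper_int f L) /\ abs_integrable f.
Proof.
  intros Ht0 Hc Hfg HK. split.
  - destruct (improper_intR_dominated_except_point (fun t => Re (f t)) g t0 K) as [L1 H1]; auto.
    { intros t Ht Hne; exact (proj1 (Hc t Ht Hne)). }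
    { intros t Ht; apply Rle_trans with (2 := Hfg t Ht), Rabs_Re_le. }
    destruct (improper_intR_dominated_except_point (fun t => Im (f t)) g t0 K) as [L2 H2]; auto.
    { intros t Ht Hne; exact (proj2 (Hc t Ht Hne)). }
    { intros t Ht; apply Rle_trans with (2 := Hfg t Ht), Rabs_Im_le. }
    exists (L1, L2); split; assumption.
  - apply (improper_intR_dominated_except_point (fun t => Cnorm (f t)) g t0 K); auto.
    + intros t Ht Hne. exact (continuous_Cnorm f t (Hc t Ht Hne)).
    + intros t Ht. rewrite Rabs_pos_eq by apply sqrt_pos. auto.
Qed.

(** * The two integrands and the final identity *)

Lemma exp_opp_lt_1 (t : R) : 0 < t -> 0 < exp (- t) < 1.
Proof.
  intros Ht. split; [apply exp_pos|]. rewrite <- exp_0. apply exp_increasing; lra.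
Qed.

(* With [x = exp (-t)], the zeta weight at [2t] is [x^2/(1-x^2) = x/(1+x) * x/(1-x)]. *)
Lemma zeta_integrand_double (tau beta : R) (a c r alpha : Cx) (t : R) : 0 < t ->
  zeta_integrand tau beta a c (Cmul (Cof 2) r) alpha (2 * t) =
  Cmul (Rcpow 2 (Csub alpha Cone))
    (Cmul (Cof (exp (- t) / (1 + exp (- t)))) (zeta_integrand tau beta a c r alpha t)).
Proof.
  intros Ht. unfold zeta_integrand.
  replace (Copp (Cdiv (Cmul (Cof 2) r) (Cof (2 * t)))) with (Copp (Cdiv r (Cof t))).
  2:{ rewrite !Cdiv_Cof by lra. apply Cx_eq; unfold Copp, Cmul, Cof, Re, Im; simpl; field; lra. }
  rewrite Rcpow_mult by lra.
  replace (exp (- (2 * t))) with (exp (- t) * exp (- t)).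
  2:{ rewrite <- exp_plus; f_equal; ring. }
  pose proof (exp_opp_lt_1 t Ht) as Hx. set (x := exp (- t)) in *.
  replace (x * x / (1 - x * x)) with (x / (1 + x) * (x / (1 - x))).
  2:{ field; repeat split; nra. }
  apply Cx_eq; unfold Cmul, Cof, Re, Im; simpl; ring.
Qed.

(* With [x = exp (-t)], [x/(1+x) = x/(1-x) - 2 x^2/(1-x^2)]. *)
Lemma eta_integrand_decomposition (tau beta : R) (a c r alpha : Cx) (t : R) : 0 < t ->
  eta_integrand tau beta a c r alpha t =
  Csub (zeta_integrand tau beta a c r alpha t)
    (Cmul (Cof 2)
      (Cmul (Cof (exp (- t) / (1 + exp (- t)))) (zeta_integrand tau beta a c r alpha t))).
Proof.
  intros Ht. unfold zeta_integrand, eta_integrand.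
  pose proof (exp_opp_lt_1 t Ht) as Hx. set (x := exp (- t)) in *.
  generalize (Phi tau beta a c (Copp (Cdiv r (Cof t)))) (Rcpow t (Csub alpha Cone)); intros P T.
  apply Cx_eq; unfold Csub, Cadd, Copp, Cmul, Cof, Re, Im; simpl; field; lra.
Qed.

Theorem theorem2 (a c : Cx) (tau beta : R) (alpha r : Cx)
  (Hca : Re c > Re a) (Ha : Re a > 0)
  (Htau : tau > 0) (Hbeta : beta > 0) (Htb : tau - beta < 1)
  (Halpha : Re alpha > 1)
  (Hr : Re r > 0 \/ r = Czero)
  (Hint : exists L : R, improper_intR
     (fun t => Rpower t (Re alpha - 1) * exp (- t) / (1 - exp (- t))
               * Cnorm (Phi tau beta a c (Copp (Cdiv r (Cof t))))) L) :
  abs_integrable (zeta_integrand tau beta a c (Cmul (Cof 2) r) alpha) /\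
  (exists I : Cx, improper_int (eta_integrand tau beta a c r alpha) I) /\
  Csub (gzeta tau beta a c r alpha)
       (Cmul (Rcpow 2 (Csub Cone alpha)) (gzeta tau beta a c (Cmul (Cof 2) r) alpha))
  = Cdiv (CInt (eta_integrand tau beta a c r alpha)) (CGamma alpha).
Proof.
  destruct Hint as [K HK].
  destruct (Phi_continuous_except_point tau beta a c r) as (t0 & Ht0 & Hc).
  set (Z := zeta_integrand tau beta a c r alpha).
  (* Everything is expressed through [Z] and [W]: the integrand for [2r] at [2t] is
     [2^(alpha-1) * W t], and the integrand of the right-hand side is [Z - 2 W]. *)
  set (W t := Cmul (Cof (exp (- t) / (1 + exp (- t)))) (Z t)).
  assert (HZc : forall t, 0 < t -> t <> t0 -> Ccontinuous Z t).
  { intros t Ht Hne. pose proof (exp_opp_lt_1 t Ht).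
    apply Ccontinuous_mul; [|exact (Hc t Ht Hne)].
    apply Ccontinuous_mul; [apply Ccontinuous_Rcpow; exact Ht|].
    apply Ccontinuous_Cof. auto_derive. lra. }
  assert (HWc : forall t, 0 < t -> t <> t0 -> Ccontinuous W t).
  { intros t Ht Hne. pose proof (exp_opp_lt_1 t Ht).
    apply Ccontinuous_mul; [|exact (HZc t Ht Hne)].
    apply Ccontinuous_Cof. auto_derive. lra. }
  (* The assumed integrand is exactly the modulus of [Z], since [t^(alpha-1)] has modulus
     [t^(Re alpha - 1)]. *)
  assert (HZn : improper_intR (fun t => Cnorm (Z t)) K).
  { eapply improper_intR_ext; [|exact HK]. intros t Ht. pose proof (exp_opp_lt_1 t Ht).
    unfold Z, zeta_integrand. rewrite !Cnorm_mul, Cnorm_Rcpow, Cnorm_Cof.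
    rewrite Rabs_pos_eq by (left; apply Rdiv_lt_0_compat; lra).
    change (Re (Csub alpha Cone)) with (Re alpha - 1). unfold Rdiv; ring. }
  assert (HWZ : forall t, 0 < t -> Cnorm (W t) <= Cnorm (Z t)).
  { intros t Ht. pose proof (exp_opp_lt_1 t Ht).
    unfold W. rewrite Cnorm_mul, Cnorm_Cof.
    rewrite Rabs_pos_eq by (left; apply Rdiv_lt_0_compat; lra).
    rewrite <- (Rmult_1_l (Cnorm (Z t))) at 2.
    apply Rmult_le_compat_r; [apply sqrt_pos|].
    apply Rle_div_l; lra. }
  (* [Z] is dominated by its own modulus, and [W] by the same function because [x/(1+x) <= 1] for
     [x = exp(-t)]. This yields the integrals [I] of [Z], [J] of [W], and [A] of the modulus of
     [W]. *)
  destruct (improper_int_dominated_except_point Z (fun t => Cnorm (Z t)) t0 K)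
    as [[I HI] _]; auto; [intros; lra|].
  destruct (improper_int_dominated_except_point W (fun t => Cnorm (Z t)) t0 K)
    as [[J HJ] [A HA]]; auto.
  set (Z2 := zeta_integrand tau beta a c (Cmul (Cof 2) r) alpha).
  set (E := eta_integrand tau beta a c r alpha).
  set (k := Rcpow 2 (Csub alpha Cone)).
  assert (HZ2 : forall t, 0 < t -> Cmul k (W (/ 2 * t)) = Z2 t).
  { intros t Ht. unfold Z2. replace t with (2 * (/ 2 * t)) at 2 by field.
    symmetry. apply zeta_integrand_double; lra. }
  (* Dilating by [1/2] divides the integral by [1/2], so the value is [2^(alpha-1) * 2J]. *)
  assert (HI2 : improper_int Z2 (Cmul k (Cdiv J (Cof (/ 2))))).
  { eapply improper_int_ext; [exact HZ2|].
    apply improper_int_mul, (improper_int_dilate W); [lra|exact HJ]. }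
  assert (HIE : improper_int E (Csub I (Cmul (Cof 2) J))).
  { eapply improper_int_ext.
    - intros t Ht. symmetry. exact (eta_integrand_decomposition tau beta a c r alpha t Ht).
    - apply improper_int_sub; [exact HI|]. apply improper_int_mul, HJ. }
  split; [|split].
  (* The modulus of [Z2 t] is that of [k] times that of [W (t/2)]; the linear combination with
     second coefficient 0 acts as multiplication by a scalar. *)
  - apply (improper_intR_dilate _ (/ 2)) in HA; [|lra].
    eexists. eapply improper_intR_ext;
      [|exact (improper_intR_lincomb _ _ (Cnorm k) 0 _ _ HA HA)].
    intros t Ht. cbv beta. fold Z2. rewrite <- HZ2, Cnorm_mul by exact Ht. ring.
  - eexists; exact HIE.
  - unfold gzeta. fold Z Z2 E.
    rewrite (CInt_eq _ _ HI), (CInt_eq _ _ HI2), (CInt_eq _ _ HIE).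
    rewrite (Cdiv_Cof J) by lra.
    unfold Cdiv. generalize (Cinv (CGamma alpha)); intros g.
    pose proof (Rcpow_opp_mul 2 alpha : Cmul (Rcpow 2 (Csub Cone alpha)) k = Cone) as Hk.
    set (u := Rcpow 2 (Csub Cone alpha)) in *.
    (* Groups [u = 2^(1-alpha)] with [k = 2^(alpha-1)], whose product is 1; both sides then equal
       [(I - 2J) * g], with [g] the inverse of the Gamma value. *)
    transitivity (Csub (Cmul I g) (Cmul (Cmul u k) (Cmul (Cmul (Cof 2) J) g))).
    + apply Cx_eq; unfold Csub, Cadd, Copp, Cmul, Cof, Re, Im; simpl; field.
    + rewrite Hk. apply Cx_eq; unfold Csub, Cadd, Copp, Cone, Cof, Cmul, Re, Im; simpl; ring.
Qed.
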